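(* For every edge $e$ of the graph $G$ (defined in the context), there is exactly one copy of $K_{2,2,2}$ and exactly one copy of $K_4$ in $G$ containing $e$, and $e$ is the only edge shared by these two copies. Consequently $G$ is fastened with respect to $K_4$ and $K_{2,2,2}$.
   Context: The Fano plane $\mathcal F$ has points $1,\dots,7$ and lines $\{1,2,3\},\{1,4,5\},\{1,6,7\},\{2,4,6\},\{2,5,7\},\{3,4,7\},\{3,5,6\}$. For a point $p$, the three lines through $p$ are $\{p,q,r\}$ for three disjoint pairs $\{q,r\}$ partitioning $\mathcal F\setminus\{p\}$. An ordered pencil through $p$ is a tuple $v=(p,q_ar_a,q_br_b,q_cr_c)$ in which $q_ar_a,q_br_b,q_cr_c$ are these three (unordered) pairs listed in a chosen linear order. The graph $G$ has the 42 ordered pencils as vertices, with $v=(p,q_ar_a,q_br_b,q_cr_c)$ and $v'=(p',q'_ar'_a,q'_br'_b,q'_cr'_c)$ adjacent iff $p\neq p'$ and $|\{q_i,r_i\}\cap\{q'_i,r'_i\}|=1$ for each $i\in\{a,b,c\}$. A copy of $H$ in $G$ is an induced subgraph isomorphic to $H$. A graph which is a union of copies of $H_1$ and also of copies of $H_2$ is called fastened if each edge lies in exactly one copy of $H_1$ and exactly one copy of $H_2$. *)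

(* Defs.v *)
From HB Require Import structures.
From mathcomp Require Import all_boot.

Set Implicit Arguments.
Unset Strict Implicit.
Unset Printing Implicit Defensive.

Record sgraph := SGraph {
  vertex :> finType;
  adj : rel vertex;
  adj_sym : symmetric adj;
  adj_irrefl : irreflexive adj
}.

Definition isomorphic (G H : sgraph) : Prop :=
  exists2 f : G -> H, bijective f & forall x y, adj (f x) (f y) = adj x y.

Section Induced.
Variables (G : sgraph) (S : {set G}).
Let V : finType := {x : G | x \in S}.
Definition induced_adj : rel V := fun x y => adj (val x) (val y).
Lemma induced_sym : symmetric induced_adj.
Proof. by move=> x y; rewrite /induced_adj adj_sym. Qed.
Lemma induced_irrefl : irreflexive induced_adj.
Proof. by move=> x; rewrite /induced_adj adj_irrefl. Qed.
Definition induced : sgraph := SGraph induced_sym induced_irrefl.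
End Induced.

Definition edges (G : sgraph) : {set {set G}} :=
  [set [set xy.1; xy.2] | xy in [set xy : G * G | adj xy.1 xy.2]].

(* An induced subgraph is determined by its vertex set S, so copies of H in G
   are represented by their vertex sets; edges_in S is the edge set of the
   induced subgraph on S, as a set of edges of G. *)
Definition edges_in (G : sgraph) (S : {set G}) : {set {set G}} :=
  [set e in edges G | e \subset S].

Definition copy (H G : sgraph) (S : {set G}) : Prop :=
  isomorphic (induced S) H.

Definition union_of_copies (H G : sgraph) : Prop :=
  exists C : {set {set G}},
    [/\ forall S, S \in C -> copy H S,
        \bigcup_(S in C) S = [set: G] &
        \bigcup_(S in C) edges_in S = edges G].

Definition fastened (H1 H2 G : sgraph) : Prop :=
  [/\ union_of_copies H1 G,
      union_of_copies H2 G &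
      forall e, e \in edges G ->
        (exists! S : {set G}, copy H1 S /\ e \in edges_in S) /\
        (exists! S : {set G}, copy H2 S /\ e \in edges_in S)].

Definition complete_adj n : rel 'I_n := fun x y => x != y.
Lemma complete_sym n : symmetric (@complete_adj n).
Proof. by move=> x y; rewrite /complete_adj eq_sym. Qed.
Lemma complete_irrefl n : irreflexive (@complete_adj n).
Proof. by move=> x; rewrite /complete_adj eqxx. Qed.
Definition complete n : sgraph := SGraph (@complete_sym n) (@complete_irrefl n).

Definition K4 : sgraph := complete 4.

(* A vertex of K_{2,2,2} is a pair (part, position in the part). *)
Definition K222_adj : rel ('I_3 * 'I_2) := fun x y => x.1 != y.1.
Lemma K222_sym : symmetric K222_adj.
Proof. by move=> x y; rewrite /K222_adj eq_sym. Qed.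
Lemma K222_irrefl : irreflexive K222_adj.
Proof. by move=> x; rewrite /K222_adj eqxx. Qed.
Definition K222 : sgraph := SGraph K222_sym K222_irrefl.

(* The ordinal x : 'I_7 stands for the point labelled x.+1 in {1, ..., 7}. *)
Definition point : finType := 'I_7.

Definition fano_labels : seq (seq nat) :=
  [:: [:: 1; 2; 3]; [:: 1; 4; 5]; [:: 1; 6; 7]; [:: 2; 4; 6];
      [:: 2; 5; 7]; [:: 3; 4; 7]; [:: 3; 5; 6]].

Definition fano_lines : seq {set point} :=
  [seq [set x : point | (x : 'I_7).+1 \in l] | l <- fano_labels].

Definition pencil_pairs (p : point) : seq {set point} :=
  [seq L :\ p | L : {set point} <- fano_lines & p \in L].

(* The positions 0, 1, 2 of the tuple are the indices a, b, c. *)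
Definition is_ordered_pencil (v : point * 3.-tuple {set point}) : bool :=
  perm_eq v.2 (pencil_pairs v.1).

Definition ordered_pencil : finType :=
  {v : point * 3.-tuple {set point} | is_ordered_pencil v}.

Definition pencil_adj : rel ordered_pencil := fun v w =>
  ((val v).1 != (val w).1) &&
  [forall i : 'I_3, #|tnth (val v).2 i :&: tnth (val w).2 i| == 1].

Lemma pencil_sym : symmetric pencil_adj.
Proof.
move=> v w; rewrite /pencil_adj eq_sym; congr (_ && _).
by apply: eq_forallb => i; rewrite setIC.
Qed.

Lemma pencil_irrefl : irreflexive pencil_adj.
Proof. by move=> v; rewrite /pencil_adj eqxx. Qed.

Definition pencil_graph : sgraph := SGraph pencil_sym pencil_irrefl.

(* Main.v *)
Require Import Defs.
From mathcomp Require Import all_boot.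

Set Implicit Arguments.
Unset Strict Implicit.
Unset Printing Implicit Defensive.

(** A copy of K4 through an edge xy is a pair of adjacent common neighbours
    c, d of x and y, and a copy of K222 through xy is a pair of non-adjacent
    common neighbours z, z' together with antipodes x', y' of x and y.  Both
    kinds of extensions of xy are unique up to exchanging c, d, resp. z, z',
    and {c, d} is disjoint from {z, z'}.  As G has only 42 vertices, this is
    checked by computation on codes of the ordered pencils by lists of
    labels. *)

(** * Searching a finite list for the cliques and octahedra through an edge *)

Section Configurations.
Variables (T : eqType) (r : rel T).

Definition clique4 x y c d :=
  [&& r x y, r x c, r x d, r y c, r y d & r c d].

Definition antipodal u v := (u != v) && ~~ r u v.

(** The parts of K_{2,2,2} are the three antipodal pairs. Each of the twelve edges occurs in one
    orientation only, chosen to agree with the tests made by [common]. *)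
Definition octahedron x x' y y' z z' :=
  [&& [&& antipodal x x', antipodal y y' & antipodal z z'],
      [&& r x y, r x y', r y x' & r x' y'],
      [&& r x z, r x z', r z x' & r x' z'] &
      [&& r y z, r y z', r z y' & r y' z']].

Variable V : seq T.

Definition common x y := [seq z <- V | r x z && r y z].

Definition antipodes x y z := [seq x' <- common y z | antipodal x x'].

Definition clique4_ext x y :=
  [seq p <- [seq (c, d) | c <- common x y, d <- common x y]
     | clique4 x y p.1 p.2].

(** Candidates are drawn from common neighbours instead of all of [V], which keeps the exhaustive
    search small; the filter adds the adjacencies still missing, such as that of x' and y'. *)
Definition octahedron_ext x y :=
  [seq o <- [seq (p, q)
               | p <- [seq (z, z') | z <- common x y, z' <- antipodes z x y],
                 q <- [seq (x', y') | x' <- antipodes x y p.1,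
                                      y' <- antipodes y x p.1]]
     | octahedron x o.2.1 y o.2.2 o.1.1 o.1.2].

(** A single copy through xy is listed exactly twice: c and d may be exchanged, and so may z and z',
    whereas x' and y' are tied to x and y. Two entries related by the swap therefore mean one
    copy. *)
Definition fastened_edge x y :=
  if (clique4_ext x y, octahedron_ext x y) is ([:: p; p'], [:: o; o']) then
    [&& p' == (p.2, p.1), o' == ((o.1.2, o.1.1), o.2),
        p.1 \notin [:: o.1.1; o.1.2] & p.2 \notin [:: o.1.1; o.1.2]]
  else false.

Lemma clique4_extP x y c d :
  reflect [/\ c \in V, d \in V & clique4 x y c d] ((c, d) \in clique4_ext x y).
Proof.
rewrite mem_filter; apply: (iffP andP) => -[].
  move=> K /allpairsP[[c0 d0] /= [cN dN [cE dE]]]; subst c0 d0.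
  by move: cN dN; rewrite !mem_filter => /andP[_ ->] /andP[_ ->].
move=> cV dV K; split=> //.
case/and5P: K => rxy rxc rxd ryc /andP[ryd rcd].
by apply: allpairs_f; rewrite mem_filter; apply/andP; split=> //; apply/andP.
Qed.

Lemma octahedron_extP x x' y y' z z' :
  reflect ([/\ x' \in V, y' \in V, z \in V & z' \in V]
           /\ octahedron x x' y y' z z')
          (((z, z'), (x', y')) \in octahedron_ext x y).
Proof.
rewrite mem_filter; apply: (iffP andP) => [[O]|[[x'V y'V zV z'V] O]].
  case/allpairsPdep=> p [q [/allpairsPdep[a [a' [aN aN' ->]]]]].
  case/allpairsPdep=> [b [b' [bN bN' ->]]] [zE z'E x'E y'E]; subst a a' b b'.
  move: aN aN' bN bN'; rewrite !mem_filter.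
  by move=> /andP[_ ->] /and3P[_ _ ->] /and3P[_ _ ->] /and3P[_ _ ->].
split=> //.
case/and4P: O => /and3P[axx' ayy' azz'] /and4P[rxy rxy' ryx' rx'y'].
move=> /and4P[rxz rxz' rzx' rx'z'] /and4P[ryz ryz' rzy' ry'z'].
apply: allpairs_f_dep; first apply: allpairs_f_dep.
- by rewrite !mem_filter rxz ryz zV.
- by rewrite !mem_filter azz' rxz' ryz' z'V.
apply: allpairs_f.
- by rewrite !mem_filter axx' ryx' rzx' x'V.
- by rewrite !mem_filter ayy' rxy' rzy' y'V.
Qed.

End Configurations.

(** * Copies of K4 and K222 as labelled configurations *)

Section Copies.
Variable G : sgraph.
Implicit Types (S : {set G}) (x y : G).

(** Replaces isomorphisms out of a subtype by embeddings into [G]. Conversely, an embedding is a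
    bijection onto its image because the cardinalities agree. *)
Lemma copyP (H : sgraph) S :
  copy H S <-> exists h : H -> G,
    [/\ injective h, forall u v, adj (h u) (h v) = adj u v
      & S = [set h u | u in H]].
Proof.
split=> [[f [g fK gK] fadj]|[h [hI hadj ->]]].
  exists (fun u => val (g u)); split.
  - by move=> u v /val_inj/(can_inj gK).
  - by move=> u v; rewrite -[adj u v](congr2 _ (gK u) (gK v)) fadj.
  apply/setP=> x; apply/idP/imsetP => [xS|[u _ ->]]; last exact: (valP (g u)).
  by exists (f (Sub x xS)) => //; rewrite fK.
pose g (u : H) : induced [set h u | u in H] :=
  Sub (h u) (imset_f h (isT : u \in H)).
have gI : injective g by move=> u v /(congr1 val) /hI.
have [|f gK fK] := inj_card_bij gI.
  by rewrite card_sig (eq_card (B := [set h u | u in H])) // card_imset.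
exists f; first by exists g.
by move=> x y; rewrite -hadj -{2}(fK x) -{2}(fK y).
Qed.

Lemma edgesP (e : {set G}) :
  reflect (exists x y, adj x y /\ e = [set x; y]) (e \in edges G).
Proof.
apply: (iffP imsetP) => [[[x y]]|[x [y [xy ->]]]].
  by rewrite inE => xy ->; exists x, y.
by exists (x, y) => //; rewrite inE.
Qed.

Lemma mem_edges_in S x y :
  adj x y -> ([set x; y] \in edges_in S) = (x \in S) && (y \in S).
Proof.
move=> xy; rewrite inE subUset !sub1set.
by case: edgesP => // -[]; exists x, y.
Qed.

(** A common edge has both ends in {x, y}, and its ends are distinct, so it is all of {x, y}. *)
Lemma edges_in_meet S T x y :
  adj x y -> S :&: T = [set x; y] ->
  edges_in S :&: edges_in T = [set [set x; y]].
Proof.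
move=> xy ST; apply/setP=> e; rewrite !inE.
apply/idP/eqP => [/andP[/andP[/edgesP[u [v [uv ->]]] eS] /andP[_ eT]]|->].
  apply/eqP; rewrite eqEcard -ST subsetI eS eT ST !cards2.
  by case: (u =P v) uv => [->|_]; rewrite ?adj_irrefl //; case: (x != y).
by rewrite -ST subsetIl subsetIr ST !andbT andbb; apply/edgesP; exists x, y.
Qed.

Lemma K4_clique4 S x y : copy K4 S -> adj x y -> x \in S -> y \in S ->
  exists c d, clique4 (@adj G) x y c d /\ S = [set x; y; c; d].
Proof.
move=> /copyP[h [hI hadj SE]] xy xS yS.
have S_adj : {in S &, forall u v, u != v -> adj u v}.
  move=> u v; rewrite SE => /imsetP[i _ ->] /imsetP[j _ ->].
  by rewrite (inj_eq hI) hadj.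
have xNy : y != x by apply: contraTneq xy => ->; rewrite adj_irrefl.
have yS' : y \in S :\ x by rewrite !inE xNy.
have: #|S :\ x :\ y| = 2.
  have := cardsD1 x S; rewrite xS (cardsD1 y (S :\ x)) yS'.
  by rewrite {1}SE card_imset // card_ord => -[].
move/eqP/cards2P=> [c [d [cNd E]]].
have /setD1P[cy /setD1P[cx cS]] : c \in S :\ x :\ y by rewrite E !inE eqxx.
have /setD1P[dy /setD1P[dx dS]] : d \in S :\ x :\ y.
  by rewrite E !inE eqxx orbT.
exists c, d; split; first by rewrite /clique4 xy !S_adj // eq_sym.
by rewrite -(setD1K xS) -(setD1K yS') E !setUA.
Qed.

Lemma clique4_K4 x y c d :
  clique4 (@adj G) x y c d -> copy K4 [set x; y; c; d].
Proof.
case/and5P=> xy xc xd yc /andP[yd cd]; apply/copyP.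
pose h (i : K4) := tnth [tuple x; y; c; d] i.
have hadj u v : adj (h u) (h v) = adj u v.
  case: u v => [[|[|[|[|//]]]] ui] [[|[|[|[|//]]]] vi];
    by rewrite /h !(tnth_nth x) /= ?adj_irrefl // adj_sym.
exists h; split=> //.
  (* Distinct vertices of K4 are adjacent, so identifying them would create a loop in [G]. *)
  move=> u v huv; apply/eqP; apply: contraFT (adj_irrefl (h u)) => uv.
  by rewrite {2}huv hadj.
apply/setP=> u; rewrite !inE -!orbA.
apply/idP/imsetP => [|[i _ ->]].
  case/or4P=> /eqP->; [exists (inord 0)|exists (inord 1)|exists (inord 2)
    |exists (inord 3)]; by rewrite // /h (tnth_nth x) inordK.
have := mem_tnth i [tuple x; y; c; d].
by rewrite !inE.
Qed.

Lemma K222_octahedron S x y : copy K222 S -> adj x y -> x \in S -> y \in S ->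
  exists x' y' z z',
    octahedron (@adj G) x x' y y' z z' /\ S = [set x; x'; y; y'; z; z'].
Proof.
move=> /copyP[h [hI hadj SE]] xy.
rewrite SE => /imsetP[[i a] _ xE] /imsetP[[j b] _ yE]; subst x y.
have ij : i != j by move: xy; rewrite hadj.
(* Adjacent x and y lie in different parts i and j; k is the third part. *)
have /cards1P[k kE] : #|~: [set i; j]| == 1.
  by rewrite cardsCs setCK cards2 ij card_ord.
have : k \in ~: [set i; j] by rewrite kE set11.
rewrite !inE negb_or => /andP[ki kj].
have flip (a0 : 'I_2) : (a0 != rev_ord a0) by case: a0 => [[|[|//]] ?].
have ord2 (a0 b0 : 'I_2) : (b0 == a0) || (b0 == rev_ord a0).
  by case: a0 b0 => [[|[|//]] ?] [[|[|//]] ?].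
(* [rev_ord] exchanges the two positions of a part, which gives the antipodes. Starting from a in
   part k is an arbitrary choice. *)
exists (h (i, rev_ord a)), (h (j, rev_ord b)), (h (k, a)), (h (k, rev_ord a)).
split.
  rewrite /octahedron /antipodal !(inj_eq hI) !hadj /= /K222_adj /=.
  by rewrite !xpair_eqE !eqxx !flip ![_ == k]eq_sym [j == i]eq_sym ij ki kj.
apply/setP=> u; apply/imsetP/idP => [[[m c] _ ->]|].
  rewrite !inE !(inj_eq hI) !xpair_eqE.
  have := ord2 a c; have := ord2 b c.
  have : m \in [set i; j] :|: [set k] by rewrite -kE setUCr inE.
  by rewrite !inE; case: (m == i); case: (m == j); case: (m == k) => //=;
    do !case: (c == _) => //=.
by rewrite !inE -!orbA; case/or4P=> [/eqP->|/eqP->|/eqP->|/or3P[]/eqP->];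
  eexists.
Qed.

Lemma octahedron_K222 x x' y y' z z' :
  octahedron (@adj G) x x' y y' z z' -> copy K222 [set x; x'; y; y'; z; z'].
Proof.
case/and4P=> /and3P[/andP[xx' /negPf axx'] /andP[yy' /negPf ayy']].
move=> /andP[zz' /negPf azz'] /and4P[xy xy' yx' x'y'].
move=> /and4P[xz xz' zx' x'z'] /and4P[yz yz' zy' y'z'].
apply/copyP.
pose h (u : K222) :=
  nth x (nth [::] [:: [:: x; x']; [:: y; y']; [:: z; z']] u.1) u.2.
have hadj u v : adj (h u) (h v) = adj u v.
  case: u v => [[[|[|[|//]]] ui] [[|[|//]] ua]];
  case=> [[[|[|[|//]]] vi] [[|[|//]] va]];
    by rewrite /h /= ?adj_irrefl // adj_sym.
exists h; split=> //.
  move=> u v huv.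
  (* Equal images force u and v into the same part; the positions then agree because antipodal
     vertices are distinct. *)
  have : ~~ adj u v by rewrite -hadj huv adj_irrefl.
  rewrite /= /K222_adj negbK; case: u v huv => i a [j b] huv /= /eqP ij.
  subst j; congr pair; apply: val_inj; move: huv xx' yy' zz'.
  by case: i a b => [[|[|[|//]]] ?] [[|[|//]] ?] [[|[|//]] ?];
    rewrite /h //= => ->; rewrite eqxx.
apply/setP=> u; rewrite !inE -!orbA.
apply/idP/imsetP => [|[[[[|[|[|//]]] ui] [[|[|//]] ua]] _ ->]];
  last first. all: try by rewrite /h /= eqxx ?orbT.
case/or4P=> [/eqP->|/eqP->|/eqP->|/or3P[]/eqP->];
  [exists (inord 0, inord 0)|exists (inord 0, inord 1)|
   exists (inord 1, inord 0)|exists (inord 1, inord 1)|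
   exists (inord 2, inord 0)|exists (inord 2, inord 1)];
  by rewrite // /h /= !inordK.
Qed.

(** Choosing one copy for each edge covers all edges, and also all vertices since none is
    isolated. *)
Lemma union_of_copies_edges (H : sgraph) :
  (forall x, exists y, adj x y) ->
  (forall e, e \in edges G -> exists S : {set G}, copy H S /\ e \in edges_in S) ->
  union_of_copies H G.
Proof.
move=> deg cov.
have /fin_all_exists[F FP] : forall e : {set G}, exists S : {set G},
    e \in edges G -> copy H S /\ e \in edges_in S.
  move=> e; case: (boolP (e \in edges G)) => [/cov[S SP]|_]; first by exists S.
  (* A dummy value: the choice function must be total on sets of vertices. *)
  by exists set0.
exists [set F e | e in edges G]; split.
- by move=> S /imsetP[e /FP[cS _] ->].
- apply/setP=> x; rewrite inE; have [y xy] := deg x.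
  have eE : [set x; y] \in edges G by apply/edgesP; exists x, y.
  apply/bigcupP; exists (F [set x; y]); first exact: imset_f.
  by have [_] := FP _ eE; rewrite mem_edges_in // => /andP[].
apply/setP=> e; apply/bigcupP/idP => [[S _]|eE]; first by rewrite inE => /andP[].
by exists (F e); [exact: imset_f | have [] := FP _ eE].
Qed.

End Copies.

(** * Transporting the search along a coding of the vertices *)

Section Coding.
Variables (G : sgraph) (T : eqType) (r : rel T) (V : seq T) (f : G -> T).
Hypothesis f_inj : injective f.
Hypothesis f_mem : forall x, f x \in V.
Hypothesis f_onto : forall t, t \in V -> exists x, f x = t.
Hypothesis f_adj : forall x y, adj x y = r (f x) (f y).

(** Existence pulls the listed entries back through [f_onto]; uniqueness codes an arbitrary
    configuration, finds it in the list by [f_mem], and cancels [f] by injectivity. *)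
Lemma fastened_edge_decode x y : fastened_edge r V (f x) (f y) ->
  exists c d x' y' z z' : G,
  [/\ clique4 (@adj G) x y c d,
      forall c1 d1, clique4 (@adj G) x y c1 d1 ->
        (c1, d1) = (c, d) \/ (c1, d1) = (d, c),
      octahedron (@adj G) x x' y y' z z',
      forall x1 y1 z1 z1', octahedron (@adj G) x x1 y y1 z1 z1' ->
        [/\ x1 = x', y1 = y' & (z1, z1') = (z, z') \/ (z1, z1') = (z', z)] &
      (c \notin [:: z; z']) && (d \notin [:: z; z'])].
Proof.
have clique4E c d :
    clique4 (@adj G) x y c d = clique4 r (f x) (f y) (f c) (f d).
  by rewrite /clique4 !f_adj.
have octahedronE x' y' z z' : octahedron (@adj G) x x' y y' z z' =
    octahedron r (f x) (f x') (f y) (f y') (f z) (f z').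
  by rewrite /octahedron /antipodal !f_adj !(inj_eq f_inj).
rewrite /fastened_edge.
case KE: clique4_ext => [|[c d] [|p' [|//]]] //.
case OE: octahedron_ext => [|[[z z'] [x' y']] [|o' [|//]]] //.
move=> /and4P[/eqP p'E /eqP o'E cz dz]; subst p' o'.
have := mem_head (c, d) [:: (d, c)].
rewrite -KE => /clique4_extP[/f_onto[c0 cE] /f_onto[d0 dE]].
have := mem_head (z, z', (x', y')) [:: (z', z, (x', y'))].
rewrite -OE => /octahedron_extP[[/f_onto[x0 xE] /f_onto[y0 yE]]].
move=> /f_onto[z0 zE] /f_onto[z0' z'E]; subst c d x' y' z z'.
rewrite -clique4E -octahedronE => O K.
exists c0, d0, x0, y0, z0, z0'; split=> //.
- move=> c1 d1; rewrite clique4E => K1.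
  have /clique4_extP := And3 (f_mem c1) (f_mem d1) K1.
  rewrite KE !inE !xpair_eqE !(inj_eq f_inj).
  by case/orP=> /andP[/eqP-> /eqP->]; [left | right].
- move=> x1 y1 z1 z1'; rewrite octahedronE => O1.
  have /octahedron_extP :=
    conj (And4 (f_mem x1) (f_mem y1) (f_mem z1) (f_mem z1')) O1.
  rewrite OE !inE !xpair_eqE !(inj_eq f_inj).
  by case/orP=> /andP[/andP[/eqP-> /eqP->] /andP[/eqP-> /eqP->]];
    split=> //; [left | right].
by move: cz dz; rewrite !inE !(inj_eq f_inj) => -> ->.
Qed.

End Coding.

(** * Coding ordered pencils by lists of labels *)

Definition labels (A : {set point}) : seq nat := [seq (x : 'I_7).+1 | x <- enum A].

Definition pencil_code (v : pencil_graph) : nat * seq (seq nat) :=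
  (((val v).1 : 'I_7).+1, map labels (val v).2).

Definition code_pairs (p : nat) : seq (seq nat) :=
  [seq [seq x <- iota 1 7 | (x != p) && (x \in l)] | l <- fano_labels & p \in l].

Definition codes : seq (nat * seq (seq nat)) :=
  [seq (p, s) | p <- iota 1 7, s <- permutations (code_pairs p)].

Definition code_adj (c d : nat * seq (seq nat)) :=
  (c.1 != d.1) &&
  all (fun i => count [in nth [::] d.2 i] (nth [::] c.2 i) == 1) (iota 0 3).

(** [enum] lists ordinals in increasing order, so the code of a set given by a predicate is a
    computable sorted list. *)
Lemma labels_set (P : pred nat) :
  labels [set x : point | P (x : 'I_7).+1] = [seq x <- iota 1 7 | P x].
Proof.
rewrite /labels /enum_mem (eq_filter (in_set _)) -enumT.
rewrite -[LHS](filter_map (fun x : 'I_7 => x.+1)).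
by rewrite (map_comp S val) val_enum_ord -(iotaDl 1 0).
Qed.

Lemma mem_labels (A : {set point}) (x : point) :
  ((x : 'I_7).+1 \in labels A) = (x \in A).
Proof. by rewrite mem_map ?mem_enum // => u v [/val_inj]. Qed.

Lemma labels_inj : injective labels.
Proof. by move=> A B AB; apply/setP=> x; rewrite -!mem_labels AB. Qed.

Lemma card_setI_labels (A B : {set point}) :
  #|A :&: B| = count [in labels B] (labels A).
Proof.
rewrite count_map -size_filter (eq_filter (a2 := [in B])); last first.
  by move=> x; rewrite /= mem_labels.
rewrite cardE /enum_mem -filter_predI; congr size; apply: eq_filter => x.
by rewrite !inE andbC.
Qed.

Lemma labels_pencil_pairs (p : point) :
  map labels (pencil_pairs p) = code_pairs (p : 'I_7).+1.
Proof.
rewrite /pencil_pairs /fano_lines filter_map -!map_comp /code_pairs.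
rewrite (eq_filter (a2 := fun l => (p : 'I_7).+1 \in l)); last first.
  by move=> l; rewrite /= inE.
apply: eq_map => l.
rewrite -(labels_set (fun x => (x != (p : 'I_7).+1) && (x \in l))).
congr labels; rewrite /=.
by apply/setP=> x; rewrite !inE eqSS.
Qed.

Lemma pencil_code_inj : injective pencil_code.
Proof.
case=> [[p s] vP] [[q t] wP] [] /= /val_inj pq /(inj_map labels_inj)/val_inj st.
by apply: val_inj; rewrite /= pq st.
Qed.

Lemma mem_codes v : pencil_code v \in codes.
Proof.
apply: allpairs_f_dep; first by rewrite mem_iota; exact: (ltn_ord ((val v).1 : 'I_7)).
by rewrite mem_permutations -labels_pencil_pairs; apply: perm_map; exact: (valP v).
Qed.

Lemma codesP c : c \in codes -> exists v, pencil_code v = c.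
Proof.
case/allpairsPdep=> p [s [p7]]; rewrite mem_permutations => sp ->.
case: p p7 sp => // p; rewrite mem_iota => p8.
have p7 : p < 7 by exact: p8.
rewrite -[p.+1]/((Ordinal p7 : point) : 'I_7).+1 -labels_pencil_pairs.
(* The reordering is recorded as a list t of indices, so that it can be replayed on the point sets
   instead of their labels. *)
set q : point := Ordinal p7 => /(perm_iotaP [::])[t tE ->].
pose u := [seq nth set0 (pencil_pairs q) i | i <- t].
have uE : perm_eq u (pencil_pairs q).
  by apply/(perm_iotaP set0); exists t => //; rewrite (perm_trans tE) // size_map.
(* Three lines pass through each point, checked point by point on the labels. *)
have u3 : size u == 3.
  rewrite (perm_size uE) -(size_map labels) labels_pencil_pairs.
  by case: q {u uE tE} => -[|[|[|[|[|[|[|//]]]]]]].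
exists (Sub (q, Tuple u3) uE : ordered_pencil); congr pair => /=.
rewrite -map_comp; apply/eq_in_map => i it /=; rewrite (nth_map set0) //.
by move: it; rewrite (perm_mem tE) mem_iota size_map.
Qed.

Lemma adj_pencil_code (v w : pencil_graph) :
  adj v w = code_adj (pencil_code v) (pencil_code w).
Proof.
rewrite -[LHS]/(pencil_adj v w); congr (_ && _).
have E (u : pencil_graph) (i : 'I_3) :
    nth [::] (map labels (val u).2) i = labels (tnth (val u).2 i).
  by rewrite (nth_map set0) ?size_tuple // -tnth_nth.
apply/forallP/allP => [H i|H i].
  rewrite mem_iota => /andP[_ i3].
  by rewrite -[i]/(nat_of_ord (Ordinal i3)) !E -card_setI_labels.
by rewrite card_setI_labels -!E H // mem_iota ltn_ord.
Qed.

(** * The finite check and its consequences for the graph *)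

Lemma codes_fastened :
  all (fun x => (has (code_adj x) codes) &&
         all (fastened_edge code_adj codes x) [seq y <- codes | code_adj x y])
      codes.
(* All 42 codes are examined by evaluation, which the kernel carries out at [Qed]. The [has]
   conjunct records that no vertex is isolated. *)
Proof. by vm_cast_no_check (erefl true). Qed.

Lemma pencil_fastened_edge (x y : pencil_graph) : adj x y ->
  fastened_edge code_adj codes (pencil_code x) (pencil_code y).
Proof.
rewrite adj_pencil_code => xy.
have /andP[_ /allP] := allP codes_fastened _ (mem_codes x).
by apply; rewrite mem_filter xy mem_codes.
Qed.

Lemma pencil_graph_edge_copies (e : {set pencil_graph}) :
  e \in edges pencil_graph ->
  [/\ exists! S : {set pencil_graph}, copy K222 S /\ e \in edges_in S,
      exists! T : {set pencil_graph}, copy K4 T /\ e \in edges_in T &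
      forall S T : {set pencil_graph},
        copy K222 S -> e \in edges_in S ->
        copy K4 T -> e \in edges_in T ->
        edges_in S :&: edges_in T = [set e]].
Proof.
case/edgesP=> x [y [xy ->]].
have [c [d [x' [y' [z [z' [K Ku O Ou disj]]]]]]] :=
  fastened_edge_decode pencil_code_inj mem_codes codesP adj_pencil_code
    (pencil_fastened_edge xy).
have KS S : copy K4 S -> [set x; y] \in edges_in S -> S = [set x; y; c; d].
  rewrite mem_edges_in // => cS /andP[xS yS].
  have [c1 [d1 [/Ku K1 ->]]] := K4_clique4 cS xy xS yS.
  (* Exchanging c and d does not change the vertex set. *)
  by case: K1 => -[-> ->] //; rewrite -!setUA [[set d] :|: _]setUC.
have OS S : copy K222 S -> [set x; y] \in edges_in S ->
    S = [set x; x'; y; y'; z; z'].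
  rewrite mem_edges_in // => cS /andP[xS yS].
  have [x1 [y1 [z1 [z1' [/Ou[-> -> O1] ->]]]]] := K222_octahedron cS xy xS yS.
  by case: O1 => -[-> ->] //; rewrite -!setUA [[set z'] :|: _]setUC.
split.
- exists [set x; x'; y; y'; z; z']; split=> [|S [cS eS]]; last by rewrite (OS S).
  by rewrite mem_edges_in // !inE !eqxx ?orbT; split=> //; exact: octahedron_K222.
- exists [set x; y; c; d]; split=> [|S [cS eS]]; last by rewrite (KS S).
  by rewrite mem_edges_in // !inE !eqxx ?orbT; split=> //; exact: clique4_K4.
move=> S T cS eS cT eT; apply: edges_in_meet => //.
rewrite (OS S) // (KS T) //.
case/and5P: K => _ xc xd yc /andP[yd cd].
case/and4P: O => /and3P[/andP[_ xx'] /andP[_ yy'] _] _ _ _.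
(* In the octahedron only z and z' are adjacent to both x and y: x and y carry no loop, and x' and
   y' each miss their antipode. As c and d are common neighbours outside {z, z'}, the two copies
   meet in {x, y}. *)
have notS u : adj x u -> adj y u -> u \notin [:: z; z'] ->
    u \in [set x; x'; y; y'; z; z'] -> False.
  move=> xu yu; rewrite !inE negb_or => /andP[uz uz'].
  rewrite (negPf uz) (negPf uz') !orbF -!orbA.
  by case/or4P=> /eqP uE; move: xu yu xx' yy';
    rewrite uE ?adj_irrefl // => xu yu; rewrite ?xu ?yu.
have /andP[cz dz] := disj.
apply/setP=> u; rewrite inE; apply/idP/idP => [/andP[uS]|].
  rewrite !inE -orbA => /orP[->//|/orP[]/eqP uE]; subst u.
  - by case: (notS c xc yc cz uS).
  - by case: (notS d xd yd dz uS).
by rewrite !inE => /orP[]->; rewrite ?orbT.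
Qed.

Theorem theorem4p3 :
  (forall e : {set pencil_graph}, e \in edges pencil_graph ->
     [/\ exists! S : {set pencil_graph}, copy K222 S /\ e \in edges_in S,
         exists! T : {set pencil_graph}, copy K4 T /\ e \in edges_in T &
         forall S T : {set pencil_graph},
           copy K222 S -> e \in edges_in S ->
           copy K4 T -> e \in edges_in T ->
           edges_in S :&: edges_in T = [set e]])
  /\ fastened K4 K222 pencil_graph.
Proof.
have deg (x : pencil_graph) : exists y, adj x y.
  have /andP[/hasP[c /codesP[y <-]]] := allP codes_fastened _ (mem_codes x).
  by rewrite -adj_pencil_code; exists y.
split; first exact: pencil_graph_edge_copies.
split.
- apply: union_of_copies_edges => // e.
  by case/pencil_graph_edge_copies=> _ [S [SP _]] _; exists S.
- apply: union_of_copies_edges => // e.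
  by case/pencil_graph_edge_copies=> [[S [SP _]]] _ _; exists S.
by move=> e /pencil_graph_edge_copies[].
Qed.
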